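(* Let $F$ be a field of characteristic not $2$ and not $3$, let $\alpha,t\in F$ with $\alpha,t\notin\{0,1\}$, and let $E$ be a vector space over $F$ of dimension $n\geq1$ endowed with a nondegenerate symmetric bilinear form $\langle\cdot,\cdot\rangle$. Then every polynomial identity of degree no more than $4$ satisfied by the algebra $S(\alpha,t,E)$ follows from commutativity.
   Context: $S(\alpha,t,E)=Fz_1\oplus Fz_2\oplus E$ is the commutative (nonassociative) $F$-algebra with bilinear product determined by $z_1^2=z_1$, $z_2^2=z_2$, $z_1z_2=0$, $ez_1=\alpha e$, $ez_2=(1-\alpha)e$, $ef=\langle e,f\rangle(z_1+tz_2)$ for $e,f\in E$. A polynomial identity of an algebra $A$ is an element $f$ of the free nonassociative $F$-algebra on countably many generators which vanishes under all substitutions of elements of $A$. It follows from commutativity if it belongs to the $T$-ideal generated by $xy-yx$, i.e. its image in the free commutative nonassociative algebra is zero. *)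

(* Defs.v *)
From HB Require Import structures.
From mathcomp Require Import all_boot all_order all_algebra.
From mathcomp Require Import ring.
From mathcomp.finmap Require Import finmap.
From mathcomp.multinomials Require Import monalg.

Set Implicit Arguments.
Unset Strict Implicit.
Unset Printing Implicit Defensive.

Import GRing.Theory.

Local Open Scope ring_scope.

(* A nonassociative (not necessarily unital) F-algebra is an lmodType A together
   with a product mul : {bilinear A -> A -> A}. *)

(* Nonassociative words in the generators x_0, x_1, ... . The free nonassociative
   algebra is {malg F[namon]}, the free module on these words, with the product
   namul below; there is no empty word, hence no constant terms. *)
Inductive namon : Type := NVar of nat | NMul of namon & namon.

Fixpoint namon_tree (m : namon) : GenTree.tree nat :=
  match m with
  | NVar i => GenTree.Leaf i
  | NMul m1 m2 => GenTree.Node 0 [:: namon_tree m1; namon_tree m2]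
  end.

Fixpoint tree_namon (t : GenTree.tree nat) : option namon :=
  match t with
  | GenTree.Leaf i => Some (NVar i)
  | GenTree.Node 0 [:: t1; t2] =>
      if tree_namon t1 is Some m1 then
        if tree_namon t2 is Some m2 then Some (NMul m1 m2) else None
      else None
  | _ => None
  end.

Lemma namon_treeK : pcancel namon_tree tree_namon.
Proof. by elim=> //= m1 -> m2 ->. Qed.

HB.instance Definition _ := Countable.copy namon (pcan_type namon_treeK).

Fixpoint namon_deg (m : namon) : nat :=
  match m with
  | NVar _ => 1
  | NMul m1 m2 => (namon_deg m1 + namon_deg m2)%N
  end.

Fixpoint namon_eval (A : Type) (mul : A -> A -> A) (s : nat -> A) (m : namon) : A :=
  match m with
  | NVar i => s i
  | NMul m1 m2 => mul (namon_eval mul s m1) (namon_eval mul s m2)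
  end.

Section FreeNonassociativeAlgebra.
Context {F : fieldType}.

Local Notation FA := {malg F[namon]}.

Definition navar (i : nat) : FA := << NVar i >>.

Definition namul (f g : FA) : FA :=
  \sum_(m1 <- msupp f) \sum_(m2 <- msupp g) << f@_m1 * g@_m2 *g NMul m1 m2 >>.

(* The degree of 0 is 0. *)
Definition nadeg (f : FA) : nat := \max_(m <- msupp f) namon_deg m.

Definition naeval (A : lmodType F) (mul : A -> A -> A) (s : nat -> A) (f : FA) : A :=
  \sum_(m <- msupp f) f@_m *: namon_eval mul s m.

Lemma naevalw (A : lmodType F) (mul : A -> A -> A) (s : nat -> A) (f : FA)
    (d : {fset namon}) : (msupp f `<=` d)%fset ->
  naeval mul s f = \sum_(m <- d) f@_m *: namon_eval mul s m.
Proof.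
move=> le_fd; rewrite /naeval (big_fset_incl _ le_fd) //= => m _.
by move/mcoeff_outdom=> ->; rewrite scale0r.
Qed.

Lemma naeval_is_linear (A : lmodType F) (mul : A -> A -> A) (s : nat -> A) :
  linear (naeval mul s).
Proof.
move=> c f g; pose d := (msupp f `|` msupp g)%fset.
have lefd : (msupp f `<=` d)%fset by apply: fsubsetUl.
have legd : (msupp g `<=` d)%fset by apply: fsubsetUr.
have led : (msupp (c *: f + g) `<=` d)%fset.
  apply: fsubset_trans (msuppD_le _ _) _.
  by rewrite fsubUset legd (fsubset_trans (msuppZ_le _ _) lefd).
rewrite (naevalw _ _ led) (naevalw _ _ lefd) (naevalw _ _ legd).
rewrite scaler_sumr -big_split /=; apply: eq_bigr => m _.
by rewrite mcoeffD mcoeffZ scalerDl scalerA.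
Qed.

HB.instance Definition _ (A : lmodType F) (mul : A -> A -> A) (s : nat -> A) :=
  GRing.isLinear.Build F FA A *:%R (naeval mul s) (naeval_is_linear mul s).

Lemma naevalU (A : lmodType F) (mul : A -> A -> A) (s : nat -> A) c m :
  naeval mul s << c *g m >> = c *: namon_eval mul s m.
Proof.
by rewrite (naevalw _ _ (d := [fset m]%fset)) ?msuppU_le // big_seq_fset1 mcoeffUU.
Qed.

Lemma namulw (f g : FA) (d1 d2 : {fset namon}) :
  (msupp f `<=` d1)%fset -> (msupp g `<=` d2)%fset ->
  namul f g = \sum_(m1 <- d1) \sum_(m2 <- d2) << f@_m1 * g@_m2 *g NMul m1 m2 >>.
Proof.
move=> le1 le2; rewrite /namul (big_fset_incl _ le1) /=.
  apply: eq_bigr => m1 _; apply: big_fset_incl => // m _ /mcoeff_outdom ->.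
  by rewrite mulr0 monalgU0.
move=> m _ /mcoeff_outdom fm; rewrite big1 // => m' _.
by rewrite fm mul0r monalgU0.
Qed.

Lemma malgUZ (a b : F) (m : namon) : << a * b *g m >> = a *: << b *g m >> :> FA.
Proof. by apply/malgP=> k; rewrite mcoeffZ !mcoeffU mulrnAr. Qed.

Lemma namul_is_bilinear : bilinear_for *:%R *:%R namul.
Proof.
split=> [g|f] c.
  move=> f1 f2; pose d := (msupp f1 `|` msupp f2)%fset.
  have le1 : (msupp f1 `<=` d)%fset by apply: fsubsetUl.
  have le2 : (msupp f2 `<=` d)%fset by apply: fsubsetUr.
  have le : (msupp (c *: f1 + f2) `<=` d)%fset.
    apply: fsubset_trans (msuppD_le _ _) _.
    by rewrite fsubUset le2 (fsubset_trans (msuppZ_le _ _) le1).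
  have leg := fsubset_refl (msupp g).
  rewrite (namulw le leg) (namulw le1 leg) (namulw le2 leg).
  rewrite /= scaler_sumr -big_split /=; apply: eq_bigr => m1 _.
  rewrite scaler_sumr -big_split /=; apply: eq_bigr => m2 _.
  by rewrite mcoeffD mcoeffZ mulrDl monalgUD -mulrA (malgUZ c).
move=> g1 g2; pose d := (msupp g1 `|` msupp g2)%fset.
have le1 : (msupp g1 `<=` d)%fset by apply: fsubsetUl.
have le2 : (msupp g2 `<=` d)%fset by apply: fsubsetUr.
have le : (msupp (c *: g1 + g2) `<=` d)%fset.
  apply: fsubset_trans (msuppD_le _ _) _.
  by rewrite fsubUset le2 (fsubset_trans (msuppZ_le _ _) le1).
have lef := fsubset_refl (msupp f).
rewrite (namulw lef le) (namulw lef le1) (namulw lef le2).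
rewrite /= scaler_sumr -big_split /=; apply: eq_bigr => m1 _.
rewrite scaler_sumr -big_split /=; apply: eq_bigr => m2 _.
by rewrite mcoeffD mcoeffZ mulrDr monalgUD mulrCA (malgUZ c).
Qed.

HB.instance Definition _ :=
  bilinear_isBilinear.Build F FA FA FA *:%R *:%R namul namul_is_bilinear.

Lemma namulUU (a b : F) (m1 m2 : namon) :
  namul << a *g m1 >> << b *g m2 >> = << a * b *g NMul m1 m2 >>.
Proof. by rewrite (namulw msuppU_le msuppU_le) !big_seq_fset1 !mcoeffUU. Qed.

Lemma naeval_var (A : lmodType F) (mul : A -> A -> A) (s : nat -> A) i :
  naeval mul s (navar i) = s i.
Proof. by rewrite naevalU scale1r. Qed.

Lemma naevalM (A : lmodType F) (mul : {bilinear A -> A -> A}) (s : nat -> A) :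
  {morph naeval mul s : f g / namul f g >-> mul f g}.
Proof.
move=> f g; rewrite /namul (linear_sum (naeval mul s)) [in RHS]/naeval linear_sumlz.
apply: eq_bigr => m1 _; rewrite (linear_sum (naeval mul s)) linear_sumr.
by apply: eq_bigr => m2 _ /=; rewrite naevalU linearZl_LR linearZr_LR /= scalerA.
Qed.

Definition polynomial_identity (A : lmodType F) (mul : {bilinear A -> A -> A})
    (f : FA) : Prop :=
  forall s : nat -> A, naeval mul s f = 0.

Definition is_ideal (A : lmodType F) (mul : {bilinear A -> A -> A})
    (I : A -> Prop) : Prop :=
  [/\ I 0,
      forall (c : F) u v, I u -> I v -> I (c *: u + v),
      forall u v, I v -> I (mul u v)
    & forall u v, I u -> I (mul u v)].

Definition is_T_ideal (I : FA -> Prop) : Prop :=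
  is_ideal namul I /\
  forall phi : {linear FA -> FA}, {morph phi : f g / namul f g} ->
    forall f, I f -> I (phi f).

Definition T_ideal_generated (G : FA -> Prop) (f : FA) : Prop :=
  forall I : FA -> Prop, is_T_ideal I -> (forall g, G g -> I g) -> I f.

Definition commutator : FA :=
  namul (navar 0) (navar 1) - namul (navar 1) (navar 0).

Definition follows_from_commutativity (f : FA) : Prop :=
  T_ideal_generated (fun g => g = commutator) f.

End FreeNonassociativeAlgebra.

(* The vector space F z_1 (+) F z_2 (+) E. *)
Definition Salg (F : fieldType) (E : vectType F) : Type := (F^o * F^o * E)%type.

HB.instance Definition _ (F : fieldType) (E : vectType F) :=
  GRing.Lmodule.on (Salg E).

Section AlgebraS.
Context {F : fieldType} {E : vectType F}.

Definition z1 : Salg E := (1, 0, 0).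
Definition z2 : Salg E := (0, 1, 0).
Definition ofE (e : E) : Salg E := (0, 0, e).

Context (alpha t : F) (form : {symmetric E}).

Definition Smul (x y : Salg E) : Salg E :=
  let: (a1, a2, e) := x in
  let: (b1, b2, f) := y in
  (a1 * b1 + form e f,
   a2 * b2 + t * form e f,
   (alpha * a1 + (1 - alpha) * a2) *: f + (alpha * b1 + (1 - alpha) * b2) *: e).

Lemma SmulC : commutative Smul.
Proof.
move=> [[a1 a2] e] [[b1 b2] f]; rewrite /Smul.
have -> : form f e = form e f by rewrite hermC expr0 mul1r.
by rewrite (mulrC a1) (mulrC a2) addrC [X in (_, X)]addrC.
Qed.

Lemma Smul_is_bilinear : bilinear_for *:%R *:%R Smul.
Proof.
have linS x : linear_for *:%R (Smul x).
  case: x => [[a1 a2] e] c [[x1 x2] u] [[y1 y2] v] /=.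
  rewrite linearDr linearZr_LR /=; congr (_, _, _) => /=.
  - by rewrite -![_ *: _]/(_ * _); ring.
  - by rewrite -![_ *: _]/(_ * _); ring.
  have -> : alpha * (c *: x1 + y1) + (1 - alpha) * (c *: x2 + y2) =
      c * (alpha * x1 + (1 - alpha) * x2) + (alpha * y1 + (1 - alpha) * y2).
    by rewrite -![_ *: _]/(_ * _); ring.
  move: (alpha * a1 + _) (alpha * x1 + _) (alpha * y1 + _) => a b d.
  rewrite [a *: _]scalerDr [(_ + d) *: e]scalerDl scalerA (mulrC a) -!scalerA.
  by rewrite addrACA -scalerDr.
by split=> // y c x x'; rewrite ![Smul _ y]SmulC linS.
Qed.

HB.instance Definition _ :=
  bilinear_isBilinear.Build F (Salg E) (Salg E) (Salg E) *:%R *:%R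
    Smul Smul_is_bilinear.

(* By bilinearity and commutativity of Smul, Salg_decomp and the multiplication
   table below determine the product. *)

Lemma Salg_decomp (a1 a2 : F) (e : E) :
  ((a1, a2, e) : Salg E) = a1 *: z1 + a2 *: z2 + ofE e.
Proof.
by congr (_, _, _); rewrite /= ?scaler0 ?addr0 ?add0r //
  -![_ *: _]/(_ * _) ?mulr0 ?mulr1 ?addr0 ?add0r.
Qed.

Lemma Smul_z1z1 : Smul z1 z1 = z1.
Proof.
by rewrite /Smul /z1 /z2 /ofE linear0l !mulr0 !mulr1 !addr0 !scaler0 addr0.
Qed.

Lemma Smul_z2z2 : Smul z2 z2 = z2.
Proof.
by rewrite /Smul /z1 /z2 /ofE linear0l !mulr0 !mulr1 !addr0 !scaler0 addr0.
Qed.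

Lemma Smul_z1z2 : Smul z1 z2 = 0.
Proof.
by rewrite /Smul /z1 /z2 /ofE linear0l !mulr0 !mul0r !addr0 !scaler0 addr0.
Qed.

Lemma Smul_ez1 (e : E) : Smul (ofE e) z1 = alpha *: ofE e.
Proof.
rewrite /Smul /z1 /z2 /ofE linear0r !(mulr0, mulr1, addr0) scale0r add0r.
by congr (_, _, _); rewrite scaler0.
Qed.

Lemma Smul_ez2 (e : E) : Smul (ofE e) z2 = (1 - alpha) *: ofE e.
Proof.
rewrite /Smul /z1 /z2 /ofE linear0r !(mulr0, mulr1, addr0, add0r) scale0r add0r.
by congr (_, _, _); rewrite scaler0.
Qed.

Lemma Smul_ef (e f : E) : Smul (ofE e) (ofE f) = form e f *: (z1 + t *: z2).
Proof.
rewrite /Smul /z1 /z2 /ofE !mulr0 !add0r !scale0r addr0.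
congr (_, _, _); rewrite /= ?scaler0 ?addr0 ?add0r ?scaler0 //.
  by rewrite -![_ *: _]/(_ * _) mulr1.
by rewrite -![_ *: _]/(_ * _) mulr1 mulrC.
Qed.

End AlgebraS.

(* Main.v *)
(* Commutativity forces the values of a word m on S(alpha, t, E) to depend only on
   its class, so that f follows from commutativity as soon as, for every word m,
   the coefficients of f at the 2 ^ (deg m - 1) rearrangements of m sum to 0.
   Inclusion-exclusion over the partial sums of a family a_1, ..., a_d substituted
   for the variables turns an identity f of degree d into multilinear identities
   whose coefficients are these class sums, in any assignment of variables to the
   a_i. It remains to see that the 1, 1, 3 or 15 multilinear words of degree
   d = 1, 2, 3, 4 are independent on S(alpha, t, E); the lower degrees are reached
   after removing the top component of f, which is itself an identity.

   For d = 4 choose e with c = <e, e> <> 0 (possible as 2 is invertible), and write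
   g and h for the coefficients of the words ((x_i x_j) x_k) x_l and
   (x_i x_j) (x_k x_l). Substituting e and z_1, z_2 gives: with A_i the sum of the
   coefficients of the six words ((x_i _) _) _, the relation
   alpha A_i + g(jk, i, l) + h(il, jk) = 0 (from e, z1, z1, z2); the vanishing of the
   sum over k of g(ij, l, k) (three e) and of the sum of h (four e, using t <> 1).
   Hence 3 alpha A = 0 and g(ij, k, l) = - h(kl, ij); the substitutions with two e
   then give 3 h = 0. *)

Require Import Defs.
From mathcomp Require Import all_boot all_order all_algebra.
From mathcomp Require Import ring zify.
From mathcomp.finmap Require Import finmap.
From mathcomp.multinomials Require Import monalg.

Set Implicit Arguments.
Unset Strict Implicit.
Unset Printing Implicit Defensive.

Import GRing.Theory.

Local Open Scope ring_scope.

(** * Rearrangements of a word under commutativity *)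

(* Listed with multiplicities: 2 ^ d.-1 entries for a word of degree d. *)
Fixpoint rearr (m : namon) : seq namon :=
  match m with
  | NVar i => [:: NVar i]
  | NMul m1 m2 => [seq NMul u v | u <- rearr m1, v <- rearr m2] ++
                  [seq NMul v u | u <- rearr m1, v <- rearr m2]
  end.

(** Induction principle for membership in [rearr]. *)
Lemma rearr_rel (R : namon -> namon -> Prop) :
    (forall i, R (NVar i) (NVar i)) ->
    (forall m1 m2 u v, R m1 u -> R m2 v -> R (NMul m1 m2) (NMul u v)) ->
    (forall m1 m2 u v, R m1 u -> R m2 v -> R (NMul m1 m2) (NMul v u)) ->
  forall m w, w \in rearr m -> R m w.
Proof.
move=> Rvar Rmul Rswap; elim=> [i | m1 IH1 m2 IH2] w /=.
  by rewrite inE => /eqP ->.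
rewrite mem_cat => /orP[] /allpairsP[[u v] /= [mu mv ->]].
  by apply: Rmul; [apply: IH1 | apply: IH2].
by apply: Rswap; [apply: IH1 | apply: IH2].
Qed.

Lemma namon_deg_gt0 (m : namon) : (0 < namon_deg m)%N.
Proof. by elim: m => //= m1 IH1 m2 _; rewrite addn_gt0 IH1. Qed.

Lemma rearr_deg (m w : namon) : w \in rearr m -> namon_deg w = namon_deg m.
Proof.
apply: (rearr_rel (R := fun m w => namon_deg w = namon_deg m)) => //=.
  by move=> m1 m2 u v -> ->.
by move=> m1 m2 u v -> ->; rewrite addnC.
Qed.

Lemma size_rearr (m : namon) : size (rearr m) = (2 ^ (namon_deg m).-1)%N.
Proof.
elim: m => //= m1 IH1 m2 IH2; rewrite size_cat !size_allpairs IH1 IH2.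
have := namon_deg_gt0 m1; have := namon_deg_gt0 m2.
case: (namon_deg m1) => // d1; case: (namon_deg m2) => // d2 _ _ /=.
by rewrite addnn -mul2n -expnD -expnS; congr (2 ^ _)%N; lia.
Qed.

Lemma NMulI (m1 m2 k1 k2 : namon) :
  (NMul m1 m2 == NMul k1 k2) = (m1 == k1) && (m2 == k2).
Proof. by apply/eqP/andP => [[-> ->] | [/eqP -> /eqP ->]]. Qed.

Lemma count_NMul (s1 s2 : seq namon) (k1 k2 : namon) :
  count_mem (NMul k1 k2) [seq NMul u v | u <- s1, v <- s2] =
  (count_mem k1 s1 * count_mem k2 s2)%N.
Proof.
elim: s1 => [|u s1 IH]; first by rewrite mul0n.
rewrite allpairs_cons count_cat IH mulnDl count_map; congr addn.
have /eq_count -> : preim (NMul u) (pred1 (NMul k1 k2)) =1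
    fun v => (u == k1) && (v == k2).
  by move=> v; exact: NMulI.
by rewrite /=; case: (u == k1); rewrite ?mul1n // mul0n count_pred0.
Qed.

Lemma count_NMulC (s1 s2 : seq namon) (k1 k2 : namon) :
  count_mem (NMul k1 k2) [seq NMul v u | u <- s1, v <- s2] =
  (count_mem k2 s1 * count_mem k1 s2)%N.
Proof.
elim: s1 => [|u s1 IH]; first by rewrite mul0n.
rewrite allpairs_cons count_cat IH mulnDl count_map; congr addn.
have /eq_count -> : preim (NMul^~ u) (pred1 (NMul k1 k2)) =1
    fun v => (u == k2) && (v == k1).
  by move=> v; rewrite andbC; exact: NMulI.
by rewrite /=; case: (u == k2); rewrite ?mul1n // mul0n count_pred0.
Qed.

Lemma count_NVar_NMul i m1 m2 : count_mem (NVar i) (rearr (NMul m1 m2)) = 0%N.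
Proof.
apply/count_memPn; rewrite mem_cat negb_or.
by apply/andP; split; apply/allpairsP => -[[u v] []].
Qed.

(** A product occurs in the direct and in the swapped half of [rearr]. By induction each count is
    symmetric, the swapped one up to the order of its two factors. *)
Lemma count_rearrC (m k : namon) :
  count_mem k (rearr m) = count_mem m (rearr k).
Proof.
elim: m k => [i | m1 IH1 m2 IH2] [j | k1 k2].
- by rewrite /= eq_sym.
- by rewrite count_NVar_NMul.
- by rewrite count_NVar_NMul.
- rewrite /= !count_cat !count_NMul !count_NMulC !IH1 !IH2 /=.
  by congr addn; rewrite mulnC.
Qed.

Lemma count_rearr_rearr (m w k : namon) :
  w \in rearr m -> count_mem k (rearr w) = count_mem k (rearr m).
Proof.
move=> wm; move: m w wm k.
apply: (rearr_rel (R := fun m w =>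
  forall k, count_mem k (rearr w) = count_mem k (rearr m))).
- by [].
- move=> m1 m2 u v IH1 IH2 [i | k1 k2]; first by rewrite !count_NVar_NMul.
  by rewrite /= !count_cat !count_NMul !count_NMulC !IH1 !IH2.
- move=> m1 m2 u v IH1 IH2 [i | k1 k2]; first by rewrite !count_NVar_NMul.
  rewrite /= !count_cat !count_NMul !count_NMulC !IH1 !IH2 addnC.
  by congr addn; rewrite mulnC.
Qed.

Lemma mem_rearr (m1 m2 u v : namon) :
  u \in rearr m1 -> v \in rearr m2 -> NMul u v \in rearr (NMul m1 m2).
Proof.
move=> um vm; rewrite mem_cat; apply/orP; left.
by apply/allpairsP; exists (u, v).
Qed.

Lemma mem_rearr_swap (m1 m2 u v : namon) :
  u \in rearr m1 -> v \in rearr m2 -> NMul v u \in rearr (NMul m1 m2).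
Proof.
move=> um vm; rewrite mem_cat; apply/orP; right.
by apply/allpairsP; exists (u, v).
Qed.

Lemma rearr_refl (m : namon) : m \in rearr m.
Proof. by elim: m => [i | m1 IH1 m2 IH2]; [rewrite mem_head | apply: mem_rearr]. Qed.

(** * Class sums and the T-ideal of the commutator *)

Section ClassSum.
Variable F : fieldType.
Local Notation FA := {malg F[namon]}.

Lemma mcoeff_sum (T : Type) (s : seq T) (G : T -> FA) (k : namon) :
  (\sum_(x <- s) G x)@_k = \sum_(x <- s) (G x)@_k.
Proof. exact: (raddf_sum (mcoeff k)). Qed.

Definition class_sum (f : FA) (m : namon) : F := \sum_(w <- rearr m) f@_w.

Lemma class_sumE (f : FA) (m : namon) :
  class_sum f m = \sum_(k <- msupp f) f@_k *+ count_mem m (rearr k).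
Proof.
have -> : class_sum f m = \sum_(w <- rearr m) \sum_(k <- msupp f) f@_k *+ (k == w).
  apply: eq_bigr => w _; rewrite {1}(monalgE f) mcoeff_sum.
  by apply: eq_bigr => k _; rewrite mcoeffU.
rewrite exchange_big; apply: eq_bigr => k _.
rewrite count_rearrC.
by elim: (rearr m) => [|w s IH]; rewrite ?big_nil // big_cons IH /= mulrnDr eq_sym.
Qed.

Lemma class_sum_rearr (f : FA) (m w : namon) :
  w \in rearr m -> class_sum f w = class_sum f m.
Proof.
move=> wm; rewrite !class_sumE; apply: eq_bigr => k _.
by rewrite -!(count_rearrC _ k) (count_rearr_rearr k wm).
Qed.

Hypothesis char_neq2 : 2%N \notin [pchar F].

Lemma two_neq0 : 2%:R != 0 :> F.
Proof. by apply: contra char_neq2 => two0; rewrite inE /= two0. Qed.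

(* Modulo K every word equals the average of its rearrangements, and the average
   of f is 0 since the relation "w is a rearrangement of m", with multiplicity,
   is symmetric. *)
Lemma class_sum0_in (f : FA) (K : FA -> Prop) :
    K 0 -> (forall (c : F) u v, K u -> K v -> K (c *: u + v)) ->
    (forall m w, w \in rearr m -> K (<< m >> - << w >>)) ->
    (forall m, class_sum f m = 0) ->
  K f.
Proof.
move=> K0 Klin Krearr f0.
(* The inverse of [size (rearr m)], the normalization of the average. *)
pose c m : F := (2 ^ (namon_deg m).-1)%:R^-1.
have c0 m : (2 ^ (namon_deg m).-1)%:R != 0 :> F.
  by rewrite natrX expf_neq0 // two_neq0.
have Ksum (T : eqType) (s : seq T) (G : T -> FA) :
    (forall x, x \in s -> K (G x)) -> K (\sum_(x <- s) G x).
  elim: s => [|x s IH] KG; first by rewrite big_nil.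
  rewrite big_cons -[G x]scale1r; apply: Klin; first by apply: KG; rewrite mem_head.
  by apply: IH => y ys; apply: KG; rewrite inE ys orbT.
have avg0 : \sum_(m <- msupp f) (f@_m * c m) *: \sum_(w <- rearr m) << w >> = 0 :> FA.
  apply/malgP => k; rewrite mcoeff0 mcoeff_sum.
  transitivity (c k * class_sum f k); last by rewrite f0 mulr0.
  rewrite class_sumE mulr_sumr.
  apply: eq_bigr => m _; rewrite mcoeffZ mcoeff_sum.
  have -> : \sum_(w <- rearr m) (<< w >> : FA)@_k = (count_mem k (rearr m))%:R.
    elim: (rearr m) => [|w s IH] /=; rewrite ?big_nil // big_cons IH mcoeffU.
    by rewrite natrD.
  have [km | km] := boolP (k \in rearr m); last first.
    by rewrite (count_memPn km) mulr0 mulr0n mulr0.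
  by rewrite /c (rearr_deg km) mulr_natr mulrnAr [f@_m * _]mulrC.
have -> : f = \sum_(m <- msupp f) (f@_m * c m) *: \sum_(w <- rearr m) (<< m >> - << w >>).
  rewrite {1}(monalgE f) -[LHS]subr0 -{2}avg0 -sumrB; apply: eq_bigr => m _.
  rewrite sumrB scalerBr; congr (_ - _).
  rewrite big_const_seq count_predT size_rearr iter_addr addr0.
  by rewrite -scaler_nat scalerA -mulrA mulVf // mulr1 -malgUZ mulr1.
apply: (Ksum) => m _; rewrite -[_ *: _]addr0; apply: Klin => //.
by apply: (Ksum) => w wm; apply: Krearr.
Qed.

(** Substituting [u] and [v] in the commutator puts every [namul u v - namul v u] in [I]. By
    induction [I] then contains the difference of a word and any of its rearrangements. *)
Lemma follows_class_sum0 (f : FA) :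
  (forall m, class_sum f m = 0) -> follows_from_commutativity f.
Proof.
move=> f0 I [[I0 Ilin Imull Imulr] Iphi] IC.
have IN u : I u -> I (- u) by move=> Iu; rewrite -scaleN1r -[_ *: _]addr0; apply: Ilin.
have ID u v : I u -> I v -> I (u + v).
  by move=> Iu Iv; rewrite -[u]scale1r; apply: Ilin.
have Icomm u v : I (namul u v - namul v u).
  pose s i := if i == 0%N then u else v.
  have phiM : {morph naeval (@namul F) s : f g / namul f g >-> namul f g}.
    by move=> g h; apply: naevalM.
  have := Iphi (naeval (@namul F) s) phiM _ (IC _ erefl).
  by rewrite /commutator linearB /= !phiM !naeval_var.
have mulU a b : << NMul a b >> = namul << a >> << b >> :> FA.
  by rewrite namulUU mulr1.
apply: (class_sum0_in (K := I)) => //.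
apply: rearr_rel => [i | m1 m2 u v I1 I2 | m1 m2 u v I1 I2].
- by rewrite subrr.
- rewrite !mulU.
  have -> : namul << m1 >> << m2 >> - namul << u >> << v >> =
      namul (<< m1 >> - << u >>) << m2 >> + namul << u >> (<< m2 >> - << v >>) :> FA.
    by rewrite linearBl linearBr addrA subrK.
  by apply: ID; [apply: Imulr | apply: Imull].
- rewrite !mulU.
  have -> : namul << m1 >> << m2 >> - namul << v >> << u >> =
      (namul (<< m1 >> - << u >>) << m2 >> + namul << u >> (<< m2 >> - << v >>))
      + (namul << u >> << v >> - namul << v >> << u >>) :> FA.
    by rewrite linearBl linearBr !addrA !subrK.
  by apply: (ID _ _ _ (Icomm _ _)); apply: ID; [apply: Imulr | apply: Imull].
Qed.

Section Evaluation.
Variables (A : lmodType F) (mul : {bilinear A -> A -> A}).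
Hypothesis mulC : commutative mul.

Lemma namon_eval_rearr (s : nat -> A) (m w : namon) :
  w \in rearr m -> namon_eval mul s w = namon_eval mul s m.
Proof.
apply: (rearr_rel (R := fun m w => namon_eval mul s w = namon_eval mul s m)) => //=.
  by move=> m1 m2 u v -> ->.
by move=> m1 m2 u v -> ->; rewrite mulC.
Qed.

Lemma naeval_class_sum0 (s : nat -> A) (f : FA) :
  (forall m, class_sum f m = 0) -> naeval mul s f = 0.
Proof.
apply: (class_sum0_in (K := fun g => naeval mul s g = 0)); first exact: linear0.
  by move=> c u v u0 v0; rewrite linearP /= u0 v0 scaler0 addr0.
move=> m w wm; rewrite linearB /= !naevalU !scale1r.
by rewrite (namon_eval_rearr s wm) subrr.
Qed.

End Evaluation.
End ClassSum.

(** * Polarization *)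

Fixpoint subseqs (T : Type) (s : seq T) : seq (seq T) :=
  if s is x :: s' then subseqs s' ++ [seq x :: r | r <- subseqs s'] else [:: [::]].

Definition consl (T : Type) (x : T) (p : seq T * seq T) := (x :: p.1, p.2).
Definition consr (T : Type) (x : T) (p : seq T * seq T) := (p.1, x :: p.2).

Fixpoint splits (T : Type) (s : seq T) : seq (seq T * seq T) :=
  if s is x :: s' then
    [seq consl x p | p <- splits s'] ++ [seq consr x p | p <- splits s']
  else [:: ([::], [::])].

(* The pairs of subsequences which together cover s, possibly overlapping. *)
Fixpoint covers (T : Type) (s : seq T) : seq (seq T * seq T) :=
  if s is x :: s' then
    [seq consl x p | p <- covers s'] ++ [seq consr x p | p <- covers s'] ++
    [seq consl x (consr x p) | p <- covers s']
  else [:: ([::], [::])].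

Lemma size_splits (T : eqType) (s : seq T) (p : seq T * seq T) :
  p \in splits s -> (size p.1 + size p.2)%N = size s.
Proof.
elim: s p => [|x s IH] p /=; first by rewrite inE => /eqP ->.
rewrite mem_cat => /orP[] /mapP[q /IH qs ->] /=; first by rewrite addSn qs.
by rewrite addnS qs.
Qed.

Lemma size_covers (T : eqType) (s : seq T) (p : seq T * seq T) :
  p \in covers s -> (size s <= size p.1 + size p.2)%N.
Proof.
elim: s p => [|x s IH] p //=.
by rewrite !mem_cat => /or3P[] /mapP[q /IH qs ->] /=; lia.
Qed.

Section SumsOverSubsequences.
Variables (T : eqType) (V : zmodType).
Implicit Types (s : seq T).

(** Inclusion-exclusion without signs: the sum over [subseqs (x :: r)] minus the one over
    [subseqs r] is the hypothesis for [fun r => X (x :: r)]. *)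
Lemma sum_subseqs0 (X : seq T -> V) :
  (forall s, \sum_(r <- subseqs s) X r = 0) -> forall s, X s = 0.
Proof.
move=> X0 s; elim: s X X0 => [|x s IH] X X0.
  by have := X0 [::]; rewrite big_seq1.
apply: (IH (fun r => X (x :: r))) => r.
by have := X0 (x :: r); rewrite big_cat /= X0 add0r big_map.
Qed.

Lemma sum_subseqs1 (G : T -> V) s :
  \sum_(r <- subseqs s) (if r is [:: j] then G j else 0) = \sum_(j <- s) G j.
Proof.
elim: s => [|x s IH]; first by rewrite big_seq1 big_nil.
rewrite big_cat big_map big_cons IH addrC; congr (_ + _).
elim: s {IH} => [|y s IH]; first by rewrite big_seq1.
by rewrite big_cat /= IH big_map big1 ?addr0 // => -[].
Qed.

(** Pairs of subsequences are grouped by the entries that they cover together. *)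
Lemma sum_subseqs_covers (G : seq T -> seq T -> V) s :
  \sum_(r1 <- subseqs s) \sum_(r2 <- subseqs s) G r1 r2 =
  \sum_(r <- subseqs s) \sum_(p <- covers r) G p.1 p.2.
Proof.
elim: s G => [|x s IH] G; first by rewrite !big_seq1.
rewrite !big_cat !big_map /= -[X in _ = X + _]IH.
under eq_bigr do rewrite big_cat big_map /=.
under [X in _ + X = _]eq_bigr do rewrite big_cat big_map /=.
under [X in _ = _ + X]eq_bigr do rewrite !big_cat !big_map /=.
rewrite !big_split /= -(IH (fun r1 r2 => G (x :: r1) r2)).
rewrite -(IH (fun r1 r2 => G r1 (x :: r2))).
rewrite -(IH (fun r1 r2 => G (x :: r1) (x :: r2))) -!addrA; congr (_ + _).
by rewrite addrCA.
Qed.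

Lemma sum_covers_splits (G : seq T * seq T -> V) s :
    (forall p : seq T * seq T, p \in covers s ->
      (size s < size p.1 + size p.2)%N -> G p = 0) ->
  \sum_(p <- covers s) G p = \sum_(p <- splits s) G p.
Proof.
elim: s G => [|x s IH] G G0 //=.
rewrite !big_cat !big_map /= [X in _ + (_ + X)]big1_seq ?addr0.
  rewrite (IH (G \o consl x)) ?(IH (G \o consr x)) // => p ps lt_s.
    by apply: G0; rewrite ?mem_cat ?map_f ?orbT //= addnS.
  by apply: G0; rewrite ?mem_cat ?map_f ?orbT.
move=> p /andP[_ ps]; apply: G0.
  by rewrite /= !mem_cat (map_f (fun q => consl x (consr x q)) ps) !orbT.
by rewrite /= addnS addSn !ltnS size_covers.
Qed.

End SumsOverSubsequences.

Fixpoint relabel (c : nat -> nat) (m : namon) : namon :=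
  match m with
  | NVar i => NVar (c i)
  | NMul m1 m2 => NMul (relabel c m1) (relabel c m2)
  end.

Lemma rearr_relabel c m : rearr (relabel c m) = map (relabel c) (rearr m).
Proof.
elim: m => //= m1 -> m2 ->.
by rewrite map_cat !map_allpairs !allpairs_mapl !allpairs_mapr.
Qed.

(* The words of degree at most n in which every entry of s occurs exactly once. *)
Fixpoint words (n : nat) (s : seq nat) : seq namon :=
  if n is n'.+1 then
    (if s is [:: j] then [:: NVar j] else [::]) ++
    flatten [seq [seq NMul u v | u <- words n' p.1, v <- words n' p.2] | p <- splits s]
  else [::].

Section Polarization.
Variables (F : fieldType) (A : lmodType F) (mul : {bilinear A -> A -> A}).
Variables (c : nat -> nat) (a : nat -> A).
Local Notation FA := {malg F[namon]}.

Definition subst (s : seq nat) (i : nat) : A :=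
  \sum_(j <- s) (if c j == i then a j else 0).

(* The part of namon_eval (subst s) m, s a set of labels, involving all of s. *)
Fixpoint polar (m : namon) (s : seq nat) : A :=
  match m with
  | NVar i => if s is [:: j] then (if c j == i then a j else 0) else 0
  | NMul m1 m2 => \sum_(p <- covers s) mul (polar m1 p.1) (polar m2 p.2)
  end.

(* The part of polar m s which is multilinear in the a j, j in s. *)
Fixpoint mpolar (m : namon) (s : seq nat) : A :=
  match m with
  | NVar i => if s is [:: j] then (if c j == i then a j else 0) else 0
  | NMul m1 m2 => \sum_(p <- splits s) mul (mpolar m1 p.1) (mpolar m2 p.2)
  end.

Lemma namon_eval_subst m s :
  namon_eval mul (subst s) m = \sum_(r <- subseqs s) polar m r.
Proof.
elim: m s => [i | m1 IH1 m2 IH2] s /=; first by rewrite sum_subseqs1.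
rewrite IH1 IH2 -(sum_subseqs_covers (fun r1 r2 => mul (polar m1 r1) (polar m2 r2))).
by rewrite linear_sumlz; apply: eq_bigr => r _; rewrite linear_sumr.
Qed.

Lemma mpolar_eq0 m s : size s != namon_deg m -> mpolar m s = 0.
Proof.
elim: m s => [i [|j []] // | m1 IH1 m2 IH2] s /= neq.
rewrite big1_seq // => p /= /size_splits ps.
have [/eqP e1|/IH1 ->] := boolP (size p.1 == namon_deg m1); last by rewrite linear0l.
rewrite (IH2 p.2) ?linear0r //; apply: contraNneq neq => e2.
by rewrite -ps e1 e2.
Qed.

(** An overlapping cover has more labels than [m] has letters, so one factor gets more labels than
    its degree and vanishes. *)
Lemma polarE m s : (namon_deg m <= size s)%N -> polar m s = mpolar m s.
Proof.
elim: m s => [i [|j []] // | m1 IH1 m2 IH2] s /= le_m.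
have zero (p : seq nat * seq nat) :
    (namon_deg m1 + namon_deg m2 < size p.1 + size p.2)%N ->
    mul (polar m1 p.1) (polar m2 p.2) = 0.
  move=> lt_p; have [lt1 | le1] := ltnP (namon_deg m1) (size p.1).
    by rewrite IH1 ?mpolar_eq0 ?linear0l //; lia.
  by rewrite IH2 ?(@mpolar_eq0 m2) ?linear0r //; lia.
have proper (p : seq nat * seq nat) : (size p.1 + size p.2)%N = size s ->
    mul (polar m1 p.1) (polar m2 p.2) = mul (mpolar m1 p.1) (mpolar m2 p.2).
  move=> ps.
  have [lt_p | le_p] := ltnP (namon_deg m1 + namon_deg m2) (size p.1 + size p.2).
    rewrite zero //; have [e1|/mpolar_eq0 ->] := eqVneq (size p.1) (namon_deg m1).
      by rewrite (@mpolar_eq0 m2) ?linear0r //; lia.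
    by rewrite linear0l.
  have [le1 | lt1] := leqP (namon_deg m1) (size p.1).
    rewrite IH1 //; have [le2 | lt2] := leqP (namon_deg m2) (size p.2).
      by rewrite IH2.
    by rewrite mpolar_eq0 ?linear0l //; lia.
  rewrite (@mpolar_eq0 m1) ?linear0l; last by lia.
  by rewrite IH2 ?mpolar_eq0 ?linear0r //; lia.
rewrite sum_covers_splits => [|p _]; last by move/(leq_ltn_trans le_m)/zero.
by apply: eq_big_seq => p /size_splits/proper.
Qed.

(** Expanding all splits lists the words in the labels [s]. A label [j] survives at a letter only if
    that letter is [c j], hence the test on [relabel c w]. *)
Lemma mpolar_words m n s : (namon_deg m <= n)%N ->
  mpolar m s =
  \sum_(w <- words n s) (if relabel c w == m then namon_eval mul a w else 0).
Proof.
elim: n m s => [|n IH] [i|m1 m2] s //= le_m.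
- by have := namon_deg_gt0 m1; lia.
- rewrite big_cat /= big_flatten big_map [X in _ + X]big1 ?addr0; last first.
    by move=> p _; rewrite big_allpairs_dep big1 // => u _; rewrite big1.
  case: s => [|j []] //; rewrite ?big_nil // big_seq1 /=.
  by congr (if _ then _ else _); apply/eqP/eqP => [->|[]].
- have := namon_deg_gt0 m1; have := namon_deg_gt0 m2 => m2_gt0 m1_gt0.
  rewrite big_cat /= big_flatten big_map.
  have -> : \sum_(w <- if s is [:: j] then [:: NVar j] else [::])
      (if relabel c w == NMul m1 m2 then namon_eval mul a w else 0) = 0.
    by case: s => [|j []]; rewrite ?big_nil ?big_seq1.
  rewrite add0r.
  apply: eq_bigr => p _; rewrite big_allpairs_dep.
  rewrite (IH m1) ?(IH m2); try by lia.
  rewrite linear_sumlz; apply: eq_bigr => u _; rewrite linear_sumr.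
  apply: eq_bigr => v _ /=; rewrite NMulI.
  case: ifP => _; last by rewrite linear0l.
  by case: ifP => _; last by rewrite linear0r.
Qed.

(** [f] vanishes at [subst s] for every [s], so [sum_subseqs0] isolates the part involving all [d]
    labels. It is multilinear as no word of [f] has degree above [d]. Several labels may share a
    variable under [c], so repeated variables are covered. *)
Lemma multilinear_identity (f : FA) (d : nat) :
    polynomial_identity mul f -> (forall m, (d < namon_deg m)%N -> f@_m = 0) ->
  \sum_(w <- words d (iota 0 d)) f@_(relabel c w) *: namon_eval mul a w = 0.
Proof.
move=> fid fdeg.
have polar0 s : \sum_(m <- msupp f) f@_m *: polar m s = 0.
  apply: (sum_subseqs0 (X := fun s => \sum_(m <- msupp f) f@_m *: polar m s)) => {}s.
  rewrite exchange_big -[RHS](fid (subst s)); apply: eq_bigr => m _.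
  by rewrite namon_eval_subst scaler_sumr.
rewrite -[RHS](polar0 (iota 0 d)).
have fle m : m \in msupp f -> (namon_deg m <= d)%N.
  by rewrite -mcoeff_neq0 leqNgt; apply: contra => /fdeg ->.
under [RHS]eq_big_seq => m /fle mf.
  rewrite polarE ?size_iota // (mpolar_words _ mf) scaler_sumr; over.
rewrite exchange_big; apply: eq_bigr => w _.
rewrite {1}(monalgE f) mcoeff_sum scaler_suml; apply: eq_bigr => m _.
rewrite mcoeffU [m == _]eq_sym.
by case: ifP => _; rewrite ?mulr1n // mulr0n scale0r scaler0.
Qed.

End Polarization.

Section ClassIdentity.
Variables (F : fieldType) (A : lmodType F) (mul : {bilinear A -> A -> A}).
Hypothesis mulC : commutative mul.
Local Notation FA := {malg F[namon]}.

(** By commutativity all rearrangements of [w] have one value, so their coefficients add up to a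
    class sum. *)
Lemma class_identity (c : nat -> nat) (a : nat -> A) (f : FA) (d : nat) (ws : seq namon) :
    polynomial_identity mul f -> (forall m, (d < namon_deg m)%N -> f@_m = 0) ->
    perm_eq (words d (iota 0 d)) (flatten (map rearr ws)) ->
  \sum_(w <- ws) class_sum f (relabel c w) *: namon_eval mul a w = 0.
Proof.
move=> fid fdeg ws_perm; rewrite -[RHS](multilinear_identity c a fid fdeg).
rewrite (perm_big _ ws_perm) /= big_flatten big_map; apply: eq_bigr => w _.
rewrite /class_sum rearr_relabel big_map scaler_suml.
by apply: eq_big_seq => u /(namon_eval_rearr mulC a) ->.
Qed.

End ClassIdentity.

(** * Representatives of words of degree at most 4 up to commutativity *)

Local Notation w2 i j := (NMul (NVar i) (NVar j)).
Local Notation w3 i j k := (NMul (w2 i j) (NVar k)).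
Local Notation w31 i j k l := (NMul (w3 i j k) (NVar l)).
Local Notation w22 i j k l := (NMul (w2 i j) (w2 k l)).

Lemma canonical_deg1 (m : namon) : namon_deg m = 1%N -> exists i, NVar i \in rearr m.
Proof.
case: m => [i|m1 m2] /=; first by exists i; rewrite mem_head.
by have := namon_deg_gt0 m1; have := namon_deg_gt0 m2; lia.
Qed.

Lemma canonical_deg2 (m : namon) :
  namon_deg m = 2%N -> exists i j, w2 i j \in rearr m.
Proof.
case: m => [//|m1 m2] /=.
have := namon_deg_gt0 m1; have := namon_deg_gt0 m2 => gt2 gt1 deg_m.
have [|i im] := @canonical_deg1 m1; first by lia.
have [|j jm] := @canonical_deg1 m2; first by lia.
by exists i, j; apply: mem_rearr.
Qed.

Lemma canonical_deg3 (m : namon) :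
  namon_deg m = 3%N -> exists i j k, w3 i j k \in rearr m.
Proof.
case: m => [//|m1 m2] /=.
have := namon_deg_gt0 m1; have := namon_deg_gt0 m2 => gt2 gt1 deg_m.
have [d1|d1] : namon_deg m1 = 1%N \/ namon_deg m1 = 2%N by lia.
  have [k km] := canonical_deg1 d1.
  have [|i [j ijm]] := @canonical_deg2 m2; first by lia.
  by exists i, j, k; apply: mem_rearr_swap.
have [i [j ijm]] := canonical_deg2 d1.
have [|k km] := @canonical_deg1 m2; first by lia.
by exists i, j, k; apply: mem_rearr.
Qed.

Lemma canonical_deg4 (m : namon) : namon_deg m = 4%N ->
  exists i j k l, w31 i j k l \in rearr m \/ w22 i j k l \in rearr m.
Proof.
case: m => [//|m1 m2] /=.
have := namon_deg_gt0 m1; have := namon_deg_gt0 m2 => gt2 gt1 deg_m.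
have [d1|[d1|d1]] : namon_deg m1 = 1%N \/ namon_deg m1 = 2%N \/ namon_deg m1 = 3%N by lia.
- have [l lm] := canonical_deg1 d1.
  have [|i [j [k ijkm]]] := @canonical_deg3 m2; first by lia.
  by exists i, j, k, l; left; apply: mem_rearr_swap.
- have [i [j ijm]] := canonical_deg2 d1.
  have [|k [l klm]] := @canonical_deg2 m2; first by lia.
  by exists i, j, k, l; right; apply: mem_rearr.
- have [i [j [k ijkm]]] := canonical_deg3 d1.
  have [|l lm] := @canonical_deg1 m2; first by lia.
  by exists i, j, k, l; left; apply: mem_rearr.
Qed.

Lemma words2 : perm_eq (words 2 (iota 0 2)) (flatten (map rearr [:: w2 0 1])).
Proof. by vm_compute. Qed.

Lemma words3 : perm_eq (words 3 (iota 0 3))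
  (flatten (map rearr [:: w3 0 1 2; w3 0 2 1; w3 1 2 0])).
Proof. by vm_compute. Qed.

(** The 15 classes of 8 words exhaust the 5 bracketings of 24 orderings. *)
Lemma words4 : perm_eq (words 4 (iota 0 4)) (flatten (map rearr
  [:: w31 0 1 2 3; w31 0 1 3 2; w31 0 2 1 3; w31 0 2 3 1; w31 0 3 1 2; w31 0 3 2 1;
      w31 1 2 0 3; w31 1 2 3 0; w31 1 3 0 2; w31 1 3 2 0; w31 2 3 0 1; w31 2 3 1 0;
      w22 0 1 2 3; w22 0 2 1 3; w22 0 3 1 2])).
Proof. by vm_compute. Qed.

(** * Multilinear identities of S(alpha, t, E) *)

Section AlgebraS.
Variables (F : fieldType) (E : vectType F) (alpha t : F) (form : {symmetric E}) (e : E).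
Local Notation S := (Salg E).
Local Notation "x ** y" := (Smul alpha t form x y) (at level 40, left associativity).
Local Notation c := (form e e).

(* The subalgebra F z1 + F z2 + F e in coordinates. *)
Definition vec (p : F * F * F) : S := (p.1.1, p.1.2, p.2 *: e).

Definition mul3 (p q : F * F * F) : F * F * F :=
  (p.1.1 * q.1.1 + p.2 * q.2 * c,
   p.1.2 * q.1.2 + t * (p.2 * q.2 * c),
   (alpha * p.1.1 + (1 - alpha) * p.1.2) * q.2 +
   (alpha * q.1.1 + (1 - alpha) * q.1.2) * p.2).

Lemma Smul_vec p q : vec p ** vec q = vec (mul3 p q).
Proof.
rewrite /vec /Smul /mul3 /= linearZl_LR linearZr_LR /=.
by rewrite !scalerA -scalerDl; congr (_, _, _); ring.
Qed.

Hypothesis c_neq0 : c != 0.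

(** As [c] is nonzero, so is [e], and coordinates can be compared. *)
Lemma vec_sum_eq0 (s : seq (F * (F * F * F))) :
    \sum_(p <- s) p.1 *: vec p.2 = 0 ->
  [/\ \sum_(p <- s) p.1 * p.2.1.1 = 0, \sum_(p <- s) p.1 * p.2.1.2 = 0 &
      \sum_(p <- s) p.1 * p.2.2 = 0].
Proof.
have -> : \sum_(p <- s) p.1 *: vec p.2 = vec (\sum_(p <- s) p.1 * p.2.1.1,
    \sum_(p <- s) p.1 * p.2.1.2, \sum_(p <- s) p.1 * p.2.2).
  elim: s => [|p s IH]; first by rewrite !big_nil /vec /= scale0r.
  by rewrite !big_cons IH /vec /= scalerDl -scalerA.
move=> /= [-> -> /eqP]; rewrite scaler_eq0 => /orP[/eqP -> // | /eqP e0].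
by have := c_neq0; rewrite e0 linear0l eqxx.
Qed.

Hypothesis three_neq0 : 3%:R != 0 :> F.
Hypotheses (a_neq0 : alpha != 0) (a_neq1 : 1 - alpha != 0).
Hypotheses (t_neq0 : t != 0) (t_neq1 : 1 - t != 0).

Local Notation Z1 := (1, 0, 0).
Local Notation Z2 := (0, 1, 0).
Local Notation Z3 := (0, 0, 1).
Let b := 1 - alpha.

Lemma mul3_Z1 x y z : mul3 (x, y, z) Z1 = (x, 0, alpha * z).
Proof. by rewrite /mul3 /=; congr (_, _, _); ring. Qed.

Lemma mul3_Z2 x y z : mul3 (x, y, z) Z2 = (0, y, b * z).
Proof. by rewrite /mul3 /= /b; congr (_, _, _); ring. Qed.

Lemma mul3_Z3 x y z : mul3 (x, y, z) Z3 = (z * c, t * (z * c), alpha * x + b * y).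
Proof. by rewrite /mul3 /= /b; congr (_, _, _); ring. Qed.

Let simp := (mul3_Z1, mul3_Z2, mul3_Z3, mulr0, mulr1, mul0r, mul1r, add0r, addr0).

Local Ltac expand eq :=
  rewrite !big_cons !big_nil !simp /mul3 /= ?simp in eq.

(** * Independence of the three multilinear words of degree 3 *)

Section Degree3.
Variable g : nat -> nat -> nat -> F.
Hypothesis terms3_eq0 : forall i j k x y u,
  \sum_(p <- [:: (g i j k, x ** y ** u); (g i k j, x ** u ** y);
                 (g j k i, y ** u ** x)]) p.1 *: p.2 = 0.

Lemma terms3_vec i j k p q r :
  let T := [:: (g i j k, mul3 (mul3 p q) r); (g i k j, mul3 (mul3 p r) q);
               (g j k i, mul3 (mul3 q r) p)] in
  [/\ \sum_(p <- T) p.1 * p.2.1.1 = 0, \sum_(p <- T) p.1 * p.2.1.2 = 0 &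
      \sum_(p <- T) p.1 * p.2.2 = 0].
Proof.
apply: vec_sum_eq0; have := terms3_eq0 i j k (vec p) (vec q) (vec r).
by rewrite !Smul_vec !big_cons !big_nil.
Qed.

Lemma degree3_eq0 i j k : g i j k = 0.
Proof.
(* With [e] at [x_k], both relations contain [g k i j + g k j i], but z_1 z_2 = 0 removes [g i j k]
   from the second. *)
have [_ _ eq1] := terms3_vec k i j Z3 Z1 Z1; expand eq1.
have [_ _ eq2] := terms3_vec k i j Z3 Z1 Z2; expand eq2.
apply: (mulfI (mulf_neq0 a_neq0 a_neq1)).
have := congr2 (fun x y => b * x - alpha * y) eq1 eq2.
by rewrite !mulr0 subr0 => <-; rewrite /b; ring.
Qed.

End Degree3.

(** * Independence of the fifteen multilinear words of degree 4 *)

Section Degree4.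
Variables g h : nat -> nat -> nat -> nat -> F.

(* g i j k l and h i j k l are the coefficients of ((x_i x_j) x_k) x_l and of
   (x_i x_j) (x_k x_l); up to commutativity there are 15 multilinear words. *)
Definition terms4 (T : Type) (mul : T -> T -> T) (i j k l : nat) (x y u v : T) :=
  let m3 x y z := mul (mul x y) z in
  let m31 x y u v := mul (m3 x y u) v in
  let m22 x y u v := mul (mul x y) (mul u v) in
  [:: (g i j k l, m31 x y u v); (g i j l k, m31 x y v u);
      (g i k j l, m31 x u y v); (g i k l j, m31 x u v y);
      (g i l j k, m31 x v y u); (g i l k j, m31 x v u y);
      (g j k i l, m31 y u x v); (g j k l i, m31 y u v x);
      (g j l i k, m31 y v x u); (g j l k i, m31 y v u x);
      (g k l i j, m31 u v x y); (g k l j i, m31 u v y x);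
      (h i j k l, m22 x y u v); (h i k j l, m22 x u y v); (h i l j k, m22 x v y u)].

Hypothesis h_sym1 : forall i j k l, h i j k l = h j i k l.
Hypothesis h_sym2 : forall i j k l, h i j k l = h k l i j.
Hypothesis terms4_eq0 : forall i j k l x y u v,
  \sum_(p <- terms4 (Smul alpha t form) i j k l x y u v) p.1 *: p.2 = 0.

Lemma terms4_vec i j k l p q r s :
  let T := terms4 mul3 i j k l p q r s in
  [/\ \sum_(p <- T) p.1 * p.2.1.1 = 0, \sum_(p <- T) p.1 * p.2.1.2 = 0 &
      \sum_(p <- T) p.1 * p.2.2 = 0].
Proof.
apply: vec_sum_eq0; have := terms4_eq0 i j k l (vec p) (vec q) (vec r) (vec s).
by rewrite /terms4 !Smul_vec !big_cons !big_nil.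
Qed.

Let A i j k l := g i j k l + g i j l k + g i k j l + g i k l j + g i l j k + g i l k j.
(** The words whose outermost product separates [x_i] from [x_j] and which have no factor
    [x_k x_l]. *)
Let M i j k l := g i k l j + g i l k j + g j k l i + g j l k i + h i k j l + h i l j k.

Local Ltac expand4 eq := rewrite /terms4 in eq; expand eq.

(* The names record the values given to x_i, x_j, x_k, x_l. Each relation
   is a coordinate of the resulting element, or a combination of two coordinates,
   divided by a nonzero scalar. *)
Lemma e_z1_z1_z2 i j k l : alpha * A i j k l + g j k i l + h i l j k = 0.
Proof.
have [_ _ eq] := terms4_vec i j k l Z3 Z1 Z1 Z2; expand4 eq.
apply: (mulfI (mulf_neq0 a_neq0 a_neq1)); rewrite mulr0 -[RHS]eq /A /b.
by ring.
Qed.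

Lemma e_e_e_z i j k l : g i j l k + g i k l j + g j k l i = 0.
Proof.
have [_ _ eq1] := terms4_vec i j k l Z3 Z3 Z3 Z1; expand4 eq1.
have [_ _ eq2] := terms4_vec i j k l Z3 Z3 Z3 Z2; expand4 eq2.
apply: (mulfI (mulf_neq0 (mulf_neq0 a_neq0 a_neq1) (mulf_neq0 c_neq0 t_neq1))).
(* All words but the three in the statement carry [alpha] in [eq1] where they carry [b] in [eq2], so
   they cancel. *)
have := congr2 (fun x y => b * x - alpha * y) eq1 eq2.
by rewrite !mulr0 subr0 => <-; rewrite /b; ring.
Qed.

Lemma e_e_e_e i j k l : h i j k l + h i k j l + h i l j k = 0.
Proof.
have [eq1 eq2 _] := terms4_vec i j k l Z3 Z3 Z3 Z3; expand4 eq1; expand4 eq2.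
apply: (mulfI (mulf_neq0 (mulf_neq0 t_neq0 t_neq1) (mulf_neq0 c_neq0 c_neq0))).
(* The [g] words take values proportional to z_1 + t z_2, which this combination kills, while
   (ee)(ee) = c^2 (z_1 + t^2 z_2). *)
have := congr2 (fun x y => t * x - y) eq1 eq2.
by rewrite !mulr0 subr0 => <-; rewrite /b; ring.
Qed.

Lemma e_e_z1_z1 i j k l : g k l i j + g k l j i = - (alpha * M i j k l).
Proof.
have [_ eq _] := terms4_vec i j k l Z3 Z3 Z1 Z1; expand4 eq.
apply/eqP; rewrite -addr_eq0; apply/eqP.
apply: (mulfI (mulf_neq0 a_neq0 (mulf_neq0 c_neq0 t_neq0))); rewrite mulr0.
by rewrite -[RHS]eq /M; ring.
Qed.

Lemma e_e_z1_z2 i j k l :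
  g i k j l + g i l j k + g j k i l + g j l i k = - M i j k l.
Proof.
have [eq1 eq2 _] := terms4_vec i j k l Z3 Z3 Z1 Z2; expand4 eq1; expand4 eq2.
apply/eqP; rewrite -addr_eq0; apply/eqP.
apply: (mulfI (mulf_neq0 (mulf_neq0 a_neq0 a_neq1) (mulf_neq0 c_neq0 t_neq0))).
(* After division, [M] has coefficient [alpha] from [eq1] and [b] from [eq2], which sum to 1. *)
have := congr2 (fun x y => alpha * t * x + b * y) eq1 eq2.
by rewrite !mulr0 addr0 => <-; rewrite /M /b; ring.
Qed.

Lemma e_e_z1_z1' i j k l : g i j k l + g i j l k + h i j k l = alpha * M i j k l.
Proof.
have [eq _ _] := terms4_vec i j k l Z3 Z3 Z1 Z1; expand4 eq.
have K := e_e_z1_z1 i j k l; have N := e_e_z1_z2 i j k l.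
apply/eqP; rewrite -subr_eq0; apply/eqP; apply: (mulfI c_neq0); rewrite mulr0.
(* The three added terms amount to [- alpha * M i j k l], written so that [K] and [N], read
   backwards, produce the words of [eq]. *)
have -> : c * (g i j k l + g i j l k + h i j k l - alpha * M i j k l) =
   c * (g i j k l + g i j l k + h i j k l + alpha * (- M i j k l) +
   alpha ^+ 2 * M i j k l + alpha * (- (alpha * M i j k l))) by ring.
by rewrite -K -N -[RHS]eq /M; ring.
Qed.

(** [A] is symmetric in [j], [k], [l], so adding [e_z1_z1_z2] over the variable that receives z_2
    counts it three times. *)
Lemma one_e_sum_eq0 i j k l : A i j k l = 0.
Proof.
apply: (mulfI (mulf_neq0 three_neq0 a_neq0)).
have -> : 3%:R * alpha * A i j k l =
    (alpha * A i j k l + g j k i l + h i l j k) +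
    (alpha * A i j l k + g j l i k + h i k j l) +
    (alpha * A i k l j + g k l i j + h i j k l) -
    (g j k i l + g j l i k + g k l i j) -
    (h i j k l + h i k j l + h i l j k) by rewrite /A; ring.
by rewrite !e_z1_z1_z2 e_e_e_z e_e_e_e !addr0 !subr0 mulr0.
Qed.

Lemma g_eq_oppr_h i j k l : g i j k l = - h k l i j.
Proof.
apply/eqP; rewrite -addr_eq0; have := e_z1_z1_z2 k i j l.
by rewrite one_e_sum_eq0 mulr0 add0r => ->.
Qed.

(** The two relations added have opposite right-hand sides, and each of their four [g] terms equals
    [- h i j k l]. *)
Lemma h_eq0 i j k l : h i j k l = 0.
Proof.
have := congr2 +%R (e_e_z1_z1' i j k l) (e_e_z1_z1 i j k l).
rewrite subrr !g_eq_oppr_h -(h_sym1 k l) -(h_sym1 i j) -(h_sym2 i j k l) => h3.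
by apply: (mulfI three_neq0); rewrite mulr0 -[RHS]oppr0 -h3; ring.
Qed.

Lemma g_eq0 i j k l : g i j k l = 0.
Proof. by rewrite g_eq_oppr_h h_eq0 oppr0. Qed.

End Degree4.
End AlgebraS.

(** If [u] and [v] are isotropic but not orthogonal, [u + v] has square 2 <u, v>. *)
Lemma exists_anisotropic (F : fieldType) (E : vectType F) (form : {symmetric E}) :
    2%N \notin [pchar F] -> (0 < \dim {:E})%N -> nondegenerate form ->
  exists e, form e e != 0.
Proof.
move=> char_neq2 dim_gt0 /eqP rad0; pose u := vpick {:E}.
have u_neq0 : u != 0 by rewrite vpick0 -dimv_eq0 -lt0n.
have /mem_orthovPn[v _ uv_neq0] : u \notin orthov form {:E}.
  by rewrite rad0 memv0.
have [uu0 | ] := eqVneq (form u u) 0; last by exists u.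
have [vv0 | ] := eqVneq (form v v) 0; last by exists v.
exists (u + v); rewrite linearDl !linearDr /= uu0 vv0 add0r addr0.
have -> : form v u = form u v by rewrite hermC expr0 mul1r.
by rewrite -mulr2n -mulr_natl mulf_neq0 // two_neq0.
Qed.

(** * Vanishing of the class sums of an identity, by descent on the degree *)

Section Main.
Variables (F : fieldType) (E : vectType F) (alpha t : F) (form : {symmetric E}) (e : E).
Hypotheses (char_neq2 : 2%N \notin [pchar F]) (char_neq3 : 3%N \notin [pchar F]).
Hypothesis c_neq0 : form e e != 0.
Hypotheses (a_neq0 : alpha != 0) (a_neq1 : 1 - alpha != 0).
Hypotheses (t_neq0 : t != 0) (t_neq1 : 1 - t != 0).
Local Notation FA := {malg F[namon]}.
Local Notation mul := (Smul alpha t form).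

Lemma three_neq0 : 3%:R != 0 :> F.
Proof. by apply: contra char_neq3 => three0; rewrite inE /= three0. Qed.

Lemma class_sum_top_eq0 (f : FA) (d : nat) (m : namon) :
    polynomial_identity mul f -> (0 < d <= 4)%N ->
    (forall m, (d < namon_deg m)%N -> f@_m = 0) ->
  namon_deg m = d -> class_sum f m = 0.
Proof.
move=> fid; case: d => [//|[|[|[|[|//]]]]] _ fdeg deg_m.
- have [i /class_sum_rearr <-] := canonical_deg1 deg_m.
  have words1 : perm_eq (words 1 (iota 0 1)) (flatten (map rearr [:: NVar 0])) by [].
  have := class_identity (@SmulC _ _ alpha t form) (fun=> i) (fun=> z1) fid fdeg words1.
  rewrite big_seq1 => /(congr1 (fun x : Salg E => x.1.1)) /=.
  by rewrite -[_ *: _]/(_ * _) mulr1.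
- have [i [j /class_sum_rearr <-]] := canonical_deg2 deg_m.
  have := class_identity (@SmulC _ _ alpha t form) (nth 0%N [:: i; j])
    (fun=> z1) fid fdeg words2.
  rewrite big_seq1 => /(congr1 (fun x : Salg E => x.1.1)) /=.
  by rewrite linear0l addr0 -[_ *: _]/(_ * _) !mulr1.
- have [i [j [k /class_sum_rearr <-]]] := canonical_deg3 deg_m.
  apply: (degree3_eq0 (t := t) c_neq0 a_neq0 a_neq1
    (g := fun i j k => class_sum f (w3 i j k))) => {}i {}j {}k x y u.
  have := class_identity (@SmulC _ _ alpha t form) (nth 0%N [:: i; j; k])
    (nth 0 [:: x; y; u]) fid fdeg words3.
  by rewrite !big_cons !big_nil.
- pose g i j k l := class_sum f (w31 i j k l).
  pose h i j k l := class_sum f (w22 i j k l).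
  have hC1 i j k l : h i j k l = h j i k l.
    apply: class_sum_rearr; apply: mem_rearr (rearr_refl _).
    by apply: mem_rearr_swap; apply: rearr_refl.
  have hC2 i j k l : h i j k l = h k l i j.
    by apply: class_sum_rearr; apply: mem_rearr_swap; apply: rearr_refl.
  have gh0 i j k l x y u v : \sum_(p <- terms4 g h mul i j k l x y u v) p.1 *: p.2 = 0.
    have := class_identity (@SmulC _ _ alpha t form) (nth 0%N [:: i; j; k; l])
      (nth 0 [:: x; y; u; v]) fid fdeg words4.
    by rewrite /terms4 !big_cons !big_nil.
  have [i [j [k [l [] /class_sum_rearr <-]]]] := canonical_deg4 deg_m.
    exact: (g_eq0 c_neq0 three_neq0 a_neq0 a_neq1 t_neq0 t_neq1 hC1 hC2 gh0).
  exact: (h_eq0 c_neq0 three_neq0 a_neq0 a_neq1 t_neq0 t_neq1 hC1 hC2 gh0).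
Qed.

Lemma class_sum_eq0 (f : FA) (d : nat) :
    polynomial_identity mul f -> (d <= 4)%N ->
    (forall m, (d < namon_deg m)%N -> f@_m = 0) ->
  forall m, class_sum f m = 0.
Proof.
elim: d f => [|d IH] f fid d_le4 fdeg m.
  (* There is no empty word, so [f] has no nonzero coefficient. *)
  by rewrite /class_sum big1 // => w _; rewrite fdeg ?namon_deg_gt0.
pose top : FA := [malg k in msupp f => if namon_deg k == d.+1 then f@_k else 0].
have topE k : top@_k = if namon_deg k == d.+1 then f@_k else 0.
  rewrite /top mcoeffE; case: ifP => // /negbT kf.
  by rewrite mcoeff_outdom // if_same.
have top0 k : class_sum top k = 0.
  have [dk | dk] := eqVneq (namon_deg k) d.+1.
    rewrite -[RHS](class_sum_top_eq0 (d := d.+1) fid d_le4 fdeg dk).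
    by apply: eq_big_seq => w /rearr_deg dw; rewrite topE dw dk eqxx.
  by apply: big1_seq => w /andP[_ /rearr_deg dw]; rewrite topE dw (negPf dk).
have low0 : forall k, class_sum (f - top) k = 0.
  apply: IH; last 1 first.
  - move=> k lt_dk; rewrite mcoeffB topE; case: eqVneq => [_|neq]; first exact: subrr.
    by rewrite fdeg ?subr0 // ltn_neqAle eq_sym neq.
  - move=> s; rewrite linearB /= fid sub0r.
    by rewrite (naeval_class_sum0 char_neq2 (@SmulC _ _ alpha t form) s top0) oppr0.
  - exact: ltnW.
rewrite -[RHS](addr0 0) -{1}(low0 m) -(top0 m) -big_split.
by apply: eq_bigr => w _; rewrite /= mcoeffB subrK.
Qed.

End Main.

(** The anisotropic vector [e] supplies the subalgebra spanned by z_1, z_2, [e], on which the class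
    sums are computed. *)
Theorem lemma10 (F : fieldType)
  (char_neq2 : 2%N \notin [pchar F]) (char_neq3 : 3%N \notin [pchar F])
  (alpha t : F)
  (alpha_neq0 : alpha <> 0) (alpha_neq1 : alpha <> 1)
  (t_neq0 : t <> 0) (t_neq1 : t <> 1)
  (n : nat) (n_ge1 : (1 <= n)%N)
  (E : vectType F) (dimE : \dim {:E} = n)
  (form : {symmetric E}) (form_nondegenerate : nondegenerate form)
  (f : {malg F[namon]}) (f_deg : (nadeg f <= 4)%N)
  (f_identity : polynomial_identity (Smul alpha t form) f) :
  follows_from_commutativity f.
Proof.
rewrite -dimE in n_ge1.
have [e c_neq0] := exists_anisotropic char_neq2 n_ge1 form_nondegenerate.
apply: (follows_class_sum0 char_neq2).
apply: (class_sum_eq0 (d := 4) char_neq2 char_neq3 c_neq0 _ _ _ _ f_identity) => //.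
- exact/eqP.
- by rewrite subr_eq0 eq_sym; apply/eqP.
- exact/eqP.
- by rewrite subr_eq0 eq_sym; apply/eqP.
move=> m lt4m; apply: mcoeff_outdom; apply: contraL lt4m => mf; rewrite -leqNgt.
by apply: leq_trans f_deg; rewrite /nadeg (big_rem m mf) leq_maxl.
Qed.
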